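(* The quantitative emptiness problem for PosLimInf and the quantitative universality problem for AsLimSup are decidable. That is, there is an algorithm that, given a probabilistic weighted automaton $A$ over $\Sigma$ (with rational data) and a rational $\nu$, decides whether there exists $w\in\Sigma^\omega$ with $L^{>0}_A(w)\ge\nu$ where the value function is $\mathsf{LimInf}$; and there is an algorithm that, given such $A$ and $\nu$, decides whether $L^{=1}_A(w)\ge\nu$ for all $w\in\Sigma^\omega$ where the value function is $\mathsf{LimSup}$.
   Context: A probabilistic weighted automaton over a finite alphabet $\Sigma$ is a tuple $A=(Q,\rho_I,\Sigma,\delta,\gamma)$ where $Q$ is a finite set of states, $\rho_I$ is a probability distribution on $Q$, $\delta:Q\times\Sigma\to\mathcal D(Q)$ assigns to each state and letter a probability distribution on $Q$, and $\gamma:Q\times\Sigma\times Q\to\mathbb Q$ is a weight function. A run over an infinite word $w=\sigma_1\sigma_2\dots$ is a sequence $r=q_0\sigma_1q_1\sigma_2\dots$ with $\rho_I(q_0)>0$ and $\delta(q_i,\sigma_{i+1})(q_{i+1})>0$ for all $i$; its weight sequence is $\gamma(r)=v_0v_1\dots$ with $v_i=\gamma(q_i,\sigma_{i+1},q_{i+1})$. For each $w$, the probabilities of finite run prefixes $\rho_I(q_0)\prod_{i=1}^k\delta(q_{i-1},\sigma_i)(q_i)$ induce a probability measure $\mathbb P^A$ on runs over $w$. For a value function $\mathrm{Val}$, $L^{>0}_A(w)=\sup\{\eta\mid \mathbb P^A(\{r:\mathrm{Val}(\gamma(r))\ge\eta\})>0\}$ (positive semantics) and $L^{=1}_A(w)=\sup\{\eta\mid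 \mathbb P^A(\{r:\mathrm{Val}(\gamma(r))\ge\eta\})=1\}$ (almost-sure semantics). $\mathsf{LimInf}(v)=\liminf_n v_n$, $\mathsf{LimSup}(v)=\limsup_n v_n$. PosLimInf is the class of $\mathsf{LimInf}$-automata under positive semantics; AsLimSup is the class of $\mathsf{LimSup}$-automata under almost-sure semantics. *)

(* Defs.v *)
From HB Require Import structures.
From Stdlib Require Lists.List.
From mathcomp Require Import all_boot all_order all_algebra.
From mathcomp Require Import all_classical all_reals all_analysis.

Set Implicit Arguments.
Unset Strict Implicit.
Unset Printing Implicit Defensive.
Import Order.TTheory GRing.Theory Num.Theory.

Inductive prf : Type :=
| PZero : prf
| PSucc : prf
| PProj : nat -> prf
| PComp : prf -> list prf -> prf
| PRec  : prf -> prf -> prf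
| PMu   : prf -> prf.

Inductive prf_eval : prf -> seq nat -> nat -> Prop :=
| ev_zero v : prf_eval PZero v 0
| ev_succ x v : prf_eval PSucc (x :: v) x.+1
| ev_proj i v : (i < size v)%N -> prf_eval (PProj i) v (nth 0%N v i)
| ev_comp f gs v rs y :
    List.Forall2 (fun g r => prf_eval g v r) gs rs ->
    prf_eval f rs y -> prf_eval (PComp f gs) v y
| ev_rec0 g h v y : prf_eval g v y -> prf_eval (PRec g h) (0%N :: v) y
| ev_recS g h m v r y :
    prf_eval (PRec g h) (m :: v) r -> prf_eval h (m :: r :: v) y ->
    prf_eval (PRec g h) (m.+1 :: v) y
| ev_mu f v m :
    prf_eval f (m :: v) 0 ->
    (forall j, (j < m)%N -> exists z, prf_eval f (j :: v) z.+1) ->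
    prf_eval (PMu f) v m.

Definition nat_pair (a b : nat) : nat := ((a + b) * (a + b).+1)./2 + b.

Definition enc_int (z : int) : nat :=
  match z with Posz m => m.*2 | Negz m => m.*2.+1 end.

Definition enc_rat (q : rat) : nat := nat_pair (enc_int (numq q)) (enc_int (denq q)).

Fixpoint enc_list (s : seq nat) : nat :=
  if s is x :: s' then (nat_pair x (enc_list s')).+1 else 0%N.

(* A probabilistic weighted automaton with state set Q = 'I_n and alphabet
   Sigma = 'I_k, with rational data. *)
Record pwa (n k : nat) := Pwa {
  rhoI  : 'I_n -> rat;
  delta : 'I_n -> 'I_k -> 'I_n -> rat;
  gamma : 'I_n -> 'I_k -> 'I_n -> rat
}.

Definition pwa_valid n k (A : pwa n k) : Prop := (
  [/\ (forall q, 0 <= rhoI A q), \sum_q rhoI A q = 1,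
      (forall q a q', 0 <= delta A q a q') &
      (forall q a, \sum_q' delta A q a q' = 1)])%R.

Definition enc_pwa n k (A : pwa n k) : nat :=
  nat_pair n (nat_pair k (nat_pair
    (enc_list [seq enc_rat (rhoI A q) | q <- enum 'I_n])
    (nat_pair
      (enc_list (flatten [seq flatten [seq [seq enc_rat (delta A q a q')
                    | q' <- enum 'I_n] | a <- enum 'I_k] | q <- enum 'I_n]))
      (enc_list (flatten [seq flatten [seq [seq enc_rat (gamma A q a q')
                    | q' <- enum 'I_n] | a <- enum 'I_k] | q <- enum 'I_n]))))).

Definition enc_input n k (A : pwa n k) (nu : rat) : nat :=
  nat_pair (enc_pwa A) (enc_rat nu).

Definition decidable_problem
    (P : forall (R : realType) n k, pwa n k -> rat -> Prop) : Prop :=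
  exists p : prf, forall (R : realType) n k (A : pwa n k) (nu : rat),
    pwa_valid A ->
    exists b : bool, prf_eval p [:: enc_input A nu] (nat_of_bool b) /\
                     (b = true <-> P R n k A nu).

Local Open Scope classical_set_scope.
Local Open Scope ring_scope.

Section Semantics.
Variables (R : realType) (n k : nat) (A : pwa n k).

(* state sequences q_0 q_1 ... ; the word is w : nat -> 'I_k with
   w i = sigma_{i+1} *)
Definition cylinder (m : nat) (f : 'I_m.+1 -> 'I_n) : set (nat -> 'I_n) :=
  [set r | forall i : 'I_m.+1, r i = f i].

Definition cylinders : set (set (nat -> 'I_n)) :=
  [set C | exists m (f : 'I_m.+1 -> 'I_n), C = cylinder f].

Definition prefix_prob (w : nat -> 'I_k) (m : nat) (f : 'I_m.+1 -> 'I_n) : R :=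
  ratr (rhoI A (f ord0)) *
  \prod_(i < m) ratr (delta A (f (widen_ord (leqnSn m) i)) (w i) (f (lift ord0 i))).

(* mu is the probability measure P^A on runs over w: a probability measure on
   the sigma-algebra generated by the cylinders, with the prescribed values on
   cylinders (it exists and is unique). *)
Definition run_measure (w : nat -> 'I_k) (mu : set (nat -> 'I_n) -> \bar R) : Prop :=
  [/\ mu set0 = 0%E,
      (forall X, <<s cylinders >> X -> (0 <= mu X)%E),
      (forall F : nat -> set (nat -> 'I_n),
          (forall i, <<s cylinders >> (F i)) -> trivIset setT F ->
          mu (\bigcup_i F i) = (\sum_(i <oo) mu (F i))%E),
      mu setT = 1%E &
      (forall m (f : 'I_m.+1 -> 'I_n), mu (cylinder f) = (prefix_prob w f)%:E)].

Definition weight_seq (w : nat -> 'I_k) (r : nat -> 'I_n) : nat -> \bar R :=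
  fun i => (ratr (gamma A (r i) (w i) (r i.+1)) : R)%:E.

Definition LimInfVal (v : nat -> \bar R) : \bar R := limn_einf v.
Definition LimSupVal (v : nat -> \bar R) : \bar R := limn_esup v.

Definition L_pos (Val : (nat -> \bar R) -> \bar R) (w : nat -> 'I_k)
    (mu : set (nat -> 'I_n) -> \bar R) : \bar R :=
  ereal_sup [set eta%:E | eta in
     [set eta : R | (0 < mu [set r | (eta%:E <= Val (weight_seq w r))%E])%E]].

Definition L_as (Val : (nat -> \bar R) -> \bar R) (w : nat -> 'I_k)
    (mu : set (nat -> 'I_n) -> \bar R) : \bar R :=
  ereal_sup [set eta%:E | eta in
     [set eta : R | mu [set r | (eta%:E <= Val (weight_seq w r))%E] = 1%E]].

End Semantics.

Definition PosLimInf_nonempty (R : realType) n k (A : pwa n k) (nu : rat) : Prop :=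
  exists w : nat -> 'I_k, forall mu, run_measure A w mu ->
    ((ratr nu : R)%:E <= L_pos A (@LimInfVal R) w mu)%E.

Definition AsLimSup_universal (R : realType) n k (A : pwa n k) (nu : rat) : Prop :=
  forall w : nat -> 'I_k, forall mu, run_measure A w mu ->
    ((ratr nu : R)%:E <= L_as A (@LimSupVal R) w mu)%E.

(* Main.v *)
From HB Require Import structures.
Require Import Defs.
From mathcomp Require Import all_boot all_order all_algebra.
From mathcomp Require Import all_classical all_reals all_analysis.
From mathcomp Require Import zify.

(* Call a transition safe when its weight is at least nu (for LimInf), resp. less
   than nu (for LimSup).  As only finitely many weights occur, both questions
   reduce to: is there a word under which, with positive probability, all but
   finitely many transitions of the run are safe?
   This holds iff some state q reachable in the support graph admits an infinite
   word all of whose runs from q are safe.  If so, prepend a finite word reaching q.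
   If not, there is a length m such that no word of length m is surely safe from
   any reachable state.  There are finitely many such words, so from every
   reachable state the probability of staying safe for m steps is at most some
   c < 1, hence for j * m steps at most c ^ j, and a run is eventually always safe
   with probability 0.
   The criterion is a statement with bounded quantifiers about states, sets of
   states and sets of sets of states, hence primitive recursive.  The measure on
   runs over a word is the image of the Lebesgue measure on [0, 1). *)

Set Implicit Arguments.
Unset Strict Implicit.
Unset Printing Implicit Defensive.
Import Order.TTheory GRing.Theory Num.Theory.
Import numFieldNormedType.Exports.

(** * Computable functions *)

(** Only lists of length [m] are constrained, because [PProj i] has no value on lists of length at
    most [i]. *)
Definition computable m (f : seq nat -> nat) : Prop :=
  exists p, forall v, size v = m -> prf_eval p v (f v).

Notation decided m P := (computable m (fun v => nat_of_bool (P v))).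

Definition prec (T : Type) (z : T) (s : nat -> T -> T) (n : nat) : T :=
  nat_rect (fun _ => T) z s n.

Lemma eq_computable m f g :
  computable m f -> (forall v, size v = m -> f v = g v) -> computable m g.
Proof. by case=> p fp fg; exists p => v sv; rewrite -fg //; exact: fp. Qed.

Lemma comp_proj m i : i < m -> computable m (fun v => nth 0 v i).
Proof. by move=> im; exists (PProj i) => v sv; constructor; rewrite sv. Qed.

Lemma comp_projb m i j : i + j < m -> computable m (fun v => nth 0 (drop j v) i).
Proof.
move=> h; apply: (eq_computable (comp_proj h)) => v _.
by rewrite nth_drop addnC.
Qed.

Lemma comp_succ m f : computable m f -> computable m (fun v => (f v).+1).
Proof.
case=> p fp; exists (PComp PSucc [:: p]) => v sv.
by apply: (@ev_comp _ _ _ [:: f v]); [do !constructor; exact: fp | constructor].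
Qed.

Lemma comp_cst m c : computable m (fun=> c).
Proof.
elim: c => [|c IH]; last exact: comp_succ.
by exists PZero => v _; constructor.
Qed.

Lemma comp1 m (F : nat -> nat) f :
  computable 1 (fun v => F (nth 0 v 0)) ->
  computable m f -> computable m (fun v => F (f v)).
Proof.
case=> P FP [p fp]; exists (PComp P [:: p]) => v sv.
apply: (@ev_comp _ _ _ [:: f v]); last exact: (FP [:: f v]).
by do !constructor; exact: fp.
Qed.

Lemma comp2 m (F : nat -> nat -> nat) f g :
  computable 2 (fun v => F (nth 0 v 0) (nth 0 v 1)) ->
  computable m f -> computable m g -> computable m (fun v => F (f v) (g v)).
Proof.
case=> P FP [p fp] [q gq]; exists (PComp P [:: p; q]) => v sv.
apply: (@ev_comp _ _ _ [:: f v; g v]); last exact: (FP [:: f v; g v]).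
by do !constructor; [exact: fp | exact: gq].
Qed.

(** Lets a program hand a block of its own arguments unchanged to a subprogram, as the parameters of
    [PRec] require. *)
Lemma forall2_proj a v i : i + a <= size v ->
  List.Forall2 (fun g r => prf_eval g v r) [seq PProj j | j <- iota i a]
    (take a (drop i v)).
Proof.
elim: a i => [|a IH] i h; first by rewrite take0; constructor.
have ih : i < size v by lia.
rewrite /= (drop_nth 0) //=; constructor; first by constructor.
by apply: IH; lia.
Qed.

(** The step program reads the counter, the previous value and then the environment, hence the arity
    [m.+2] and [drop 2 v]. *)
Lemma comp_prec m B z s :
  computable m B -> computable m z ->
  computable m.+2 (fun v => s (nth 0 v 0) (nth 0 v 1) (drop 2 v)) ->
  computable m (fun v => prec (z v) (fun i x => s i x v) (B v)).
Proof.
case=> b bP [p pP] [q qP].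
exists (PComp (PRec p q) (b :: [seq PProj j | j <- iota 0 m])) => v sv.
apply: (@ev_comp _ _ _ (B v :: v)).
  constructor; first exact: bP.
  have := @forall2_proj m v 0; rewrite drop0 add0n -sv take_size; exact.
elim: (B v) => [|n IH]; first by constructor; exact: pP.
apply: (ev_recS IH).
by have := qP [:: n, prec (z v) (fun i x => s i x v) n & v]; rewrite /= drop0 sv; apply.
Qed.

Lemma comp_add m f g :
  computable m f -> computable m g -> computable m (fun v => f v + g v).
Proof.
apply: (@comp2 _ addn).
have h : computable 2 (fun v => prec (nth 0 v 0) (fun i x => x.+1) (nth 0 v 1)).
  by apply: comp_prec; do ?[exact: comp_proj | apply: comp_succ].
apply: (eq_computable h) => v _.
by elim: (nth 0 v 1) => [|n IH]; rewrite ?addn0 //= -addSnnS addSn IH.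
Qed.

Lemma comp_mul m f g :
  computable m f -> computable m g -> computable m (fun v => f v * g v).
Proof.
apply: (@comp2 _ muln).
have h : computable 2 (fun v => prec 0 (fun i x => x + nth 0 v 0) (nth 0 v 1)).
  apply: comp_prec; [exact: comp_proj | exact: comp_cst |].
  by apply: comp_add; [exact: comp_proj | exact: (@comp_projb 4 0 2)].
apply: (eq_computable h) => v _.
by elim: (nth 0 v 1) => [|n IH]; rewrite ?muln0 //= IH mulnSr.
Qed.

Lemma comp_pred m f : computable m f -> computable m (fun v => (f v).-1).
Proof.
apply: (@comp1 _ predn).
have h : computable 1 (fun v => prec 0 (fun i x => i) (nth 0 v 0)).
  by apply: comp_prec; [exact: comp_proj | exact: comp_cst | exact: comp_proj].
by apply: (eq_computable h) => v _; case: (nth 0 v 0).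
Qed.

Lemma comp_sub m f g :
  computable m f -> computable m g -> computable m (fun v => f v - g v).
Proof.
apply: (@comp2 _ subn).
have h : computable 2 (fun v => prec (nth 0 v 0) (fun i x => x.-1) (nth 0 v 1)).
  by apply: comp_prec; do ?[exact: comp_proj | apply: comp_pred].
apply: (eq_computable h) => v _.
by elim: (nth 0 v 1) => [|n IH]; rewrite ?subn0 //= IH subnS.
Qed.

Lemma comp_exp m f g :
  computable m f -> computable m g -> computable m (fun v => f v ^ g v).
Proof.
apply: (@comp2 _ expn).
have h : computable 2 (fun v => prec 1 (fun i x => x * nth 0 v 0) (nth 0 v 1)).
  apply: comp_prec; [exact: comp_proj | exact: comp_cst |].
  by apply: comp_mul; [exact: comp_proj | exact: (@comp_projb 4 0 2)].
apply: (eq_computable h) => v _.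
by elim: (nth 0 v 1) => [|n IH]; rewrite ?expn0 //= IH expnSr.
Qed.

Lemma dec_not m P : decided m P -> decided m (fun v => ~~ P v).
Proof.
move=> h; have := comp_sub (comp_cst m 1) h; move/eq_computable; apply=> v _.
by case: (P v).
Qed.

Lemma dec_and m P Q : decided m P -> decided m Q -> decided m (fun v => P v && Q v).
Proof.
move=> h h'; have := comp_mul h h'; move/eq_computable; apply=> v _.
by case: (P v); case: (Q v).
Qed.

Lemma dec_imp m P Q : decided m P -> decided m Q -> decided m (fun v => P v ==> Q v).
Proof.
move=> h h'; have := dec_not (dec_and h (dec_not h')).
by move/eq_computable; apply=> v _; case: (P v); case: (Q v).
Qed.

Lemma dec_leq m f g :
  computable m f -> computable m g -> decided m (fun v => f v <= g v).
Proof.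
move=> h h'; have := comp_sub (comp_cst m 1) (comp_sub h h').
by move/eq_computable; apply=> v _; rewrite /leq; case: (f v - g v).
Qed.

Lemma dec_eq m f g :
  computable m f -> computable m g -> decided m (fun v => f v == g v).
Proof.
move=> h h'; have := dec_and (dec_leq h h') (dec_leq h' h).
by move/eq_computable; apply=> v _; rewrite eqn_leq.
Qed.

(** * Bounded sums and bounded quantifiers *)

Definition bsum B (F : nat -> nat) := \sum_(0 <= i < B) F i.
Definition ball B (P : pred nat) := all P (iota 0 B).
Definition bex B (P : pred nat) := ~~ ball B (fun i => ~~ P i).

Lemma comp_bsum m B F :
  computable m B -> computable m.+1 (fun v => F (nth 0 v 0) (drop 1 v)) ->
  computable m (fun v => bsum (B v) (fun i => F i v)).
Proof.
move=> hB [p pP].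
have h : computable m (fun v => prec 0 (fun i x => x + F i v) (B v)).
  apply: comp_prec => //; first exact: comp_cst.
  apply: comp_add; first exact: comp_proj.
  (* The recursion supplies the accumulator as second argument; the summand must not see it, so only
     the counter and the environment are forwarded. *)
  exists (PComp p (PProj 0 :: [seq PProj j | j <- iota 2 m])) => v sv.
  apply: (@ev_comp _ _ _ (nth 0 v 0 :: drop 2 v)).
    constructor; first by constructor; rewrite sv.
    have := @forall2_proj m v 2; rewrite sv => /(_ (leqnn _)).
    by rewrite take_oversize // size_drop sv subn2.
  have := pP (nth 0 v 0 :: drop 2 v); rewrite /= drop0; apply.
  by rewrite size_drop sv subn2.
apply: (eq_computable h) => v _; rewrite /bsum.
elim: (B v) => [|n IH]; first by rewrite big_nil.
by rewrite big_nat_recr //= IH.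
Qed.

(** The number of counterexamples is a bounded sum, and it is compared with zero. *)
Lemma dec_ball m B P :
  computable m B -> decided m.+1 (fun v => P (nth 0 v 0) (drop 1 v)) ->
  decided m (fun v => ball (B v) (fun i => P i v)).
Proof.
move=> hB hP.
have h := @comp_bsum m B (fun i v => nat_of_bool (~~ P i v)) hB (dec_not hP).
have := dec_eq h (comp_cst m 0); move/eq_computable; apply=> v _.
congr nat_of_bool; rewrite /bsum /ball sum_nat_seq_eq0 /index_iota subn0.
by apply: eq_all => i; case: (P i v).
Qed.

Lemma dec_bex m B P :
  computable m B -> decided m.+1 (fun v => P (nth 0 v 0) (drop 1 v)) ->
  decided m (fun v => bex (B v) (fun i => P i v)).
Proof.
move=> hB hP; apply: dec_not.
exact: (@dec_ball m B (fun i v => ~~ P i v) hB (dec_not hP)).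
Qed.

Lemma ballP B (P : pred nat) : reflect (forall i, i < B -> P i) (ball B P).
Proof.
apply: (iffP allP) => h i; first by move=> iB; apply: h; rewrite mem_iota.
by rewrite mem_iota => /andP[_]; exact: h.
Qed.

Lemma bexP B (P : pred nat) : reflect (exists2 i, i < B & P i) (bex B P).
Proof.
apply: (iffP allPn) => [[i]|[i iB Pi]].
  by rewrite mem_iota negbK => /andP[_ iB] Pi; exists i.
by exists i; rewrite ?mem_iota ?negbK.
Qed.

(** Halving is a bounded count: [n./2] is the number of [i < n] with [i.+1 * 2 <= n]. *)
Lemma comp_half m f : computable m f -> computable m (fun v => (f v)./2).
Proof.
apply: (@comp1 _ half).
have h : computable 1
    (fun v => bsum (nth 0 v 0) (fun i => nat_of_bool (i.+1 * 2 <= nth 0 v 0))).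
  apply: comp_bsum; first exact: comp_proj.
  apply: dec_leq; last exact: (@comp_projb 2 0 1).
  by apply: comp_mul; [apply: comp_succ; exact: comp_proj | exact: comp_cst].
apply: (eq_computable h) => v _; move: (nth 0 v 0) => n.
have H b c : c <= b -> \sum_(0 <= i < b) nat_of_bool (i < c) = c.
  elim: b c => [|b IH] c cb; first by rewrite big_nil; lia.
  rewrite big_nat_recr //=; case: (ltngtP c b.+1) cb => // [cb _|-> _].
    by rewrite IH; lia.
  rewrite -[in RHS](IH b) // addn1; congr _.+1.
  by apply: eq_big_nat => i /andP[_ ib]; congr nat_of_bool; lia.
rewrite /bsum -[RHS](H n); last by lia.
by apply: eq_bigr => i _; congr nat_of_bool; lia.
Qed.

Lemma dec_odd m f : computable m f -> decided m (fun v => odd (f v)).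
Proof.
move=> h; have := dec_not (dec_eq h (comp_mul (comp_half h) (comp_cst m 2))).
by move/eq_computable; apply=> v _; congr nat_of_bool; lia.
Qed.

Lemma comp_iter m N (F : nat -> nat) z :
  computable 1 (fun v => F (nth 0 v 0)) -> computable m N -> computable m z ->
  computable m (fun v => iter (N v) F (z v)).
Proof.
move=> hF hN hz.
have h : computable m (fun v => prec (z v) (fun i x => F x) (N v)).
  by apply: comp_prec => //; apply: comp1 => //; exact: comp_proj.
by apply: (eq_computable h) => v _; elim: (N v) => //= n ->.
Qed.

(** Leaves the index [i] to unification, so that a variable below several binders becomes a
    projection once its nested [drop]s are merged. *)
Lemma comp_env m (e : seq nat -> nat) i :
  i < m -> (forall v, e v = nth 0 v i) -> computable m e.
Proof. by move=> im ei; apply: (eq_computable (comp_proj im)) => v. Qed.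

(* An environment [v] extended under binders appears as [drop 1 (... (drop 1 v))]. *)
Ltac computability := cbv beta; lazymatch goal with
  | |- computable _ (fun v => addn _ _) => apply: comp_add
  | |- computable _ (fun v => muln _ _) => apply: comp_mul
  | |- computable _ (fun v => subn _ _) => apply: comp_sub
  | |- computable _ (fun v => expn _ _) => apply: comp_exp
  | |- computable _ (fun v => S _) => first [exact: comp_cst | apply: comp_succ]
  | |- computable _ (fun v => predn _) => apply: comp_pred
  | |- computable _ (fun v => half _) => apply: comp_half
  | |- computable _ (fun v => nat_of_bool (negb _)) => apply: dec_not
  | |- computable _ (fun v => nat_of_bool (andb _ _)) => apply: dec_and
  | |- computable _ (fun v => nat_of_bool (implb _ _)) => apply: dec_imp
  | |- computable _ (fun v => nat_of_bool (leq _ _)) => apply: dec_leq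
  | |- computable _ (fun v => nat_of_bool (eq_op _ _)) => apply: dec_eq
  | |- computable _ (fun v => nat_of_bool (odd _)) => apply: dec_odd
  | |- computable _ (fun v => nat_of_bool (ball _ _)) => apply: dec_ball
  | |- computable _ (fun v => nat_of_bool (bex _ _)) => apply: dec_bex
  | |- computable _ (fun v => bsum _ _) => apply: comp_bsum
  | |- computable _ (fun v => iter _ _ _) => apply: comp_iter
  | |- computable _ (fun v => nth 0 _ _) =>
      eapply comp_env; last by move=> v; rewrite ?nth_drop; reflexivity
  | |- computable _ (fun v => _) => exact: comp_cst
  | |- is_true _ => reflexivity
  end.

(** * Decoding of pairs, lists and rationals *)

Definition unpair1 z :=
  bsum z.+1 (fun a => bsum z.+1 (fun b => a * (nat_pair a b == z))).
Definition unpair2 z :=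
  bsum z.+1 (fun a => bsum z.+1 (fun b => b * (nat_pair a b == z))).

Lemma comp_unpair1 m f : computable m f -> computable m (fun v => unpair1 (f v)).
Proof. apply: (@comp1 _ unpair1); rewrite /unpair1 /nat_pair; do !computability. Qed.

Lemma comp_unpair2 m f : computable m f -> computable m (fun v => unpair2 (f v)).
Proof. apply: (@comp1 _ unpair2); rewrite /unpair2 /nat_pair; do !computability. Qed.

Definition code_tail z := unpair2 z.-1.
Definition code_nth z i := unpair1 (iter i code_tail z).-1.

Lemma comp_code_nth m f g : computable m f -> computable m g ->
  computable m (fun v => code_nth (f v) (g v)).
Proof.
apply: (@comp2 _ code_nth); apply: comp_unpair1; apply: comp_pred.
apply: comp_iter; do ?computability.
by rewrite /code_tail; apply: comp_unpair2; do !computability.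
Qed.

(** Positive and negative part of a coded integer. Even codes are the non-negative ones, and
    [Negz m] is [-(m + 1)], whence the successor in [int_neg]. *)
Definition int_pos z := ~~ odd z * z./2.
Definition int_neg z := odd z * z./2.+1.

(** Cross-multiplication by the positive denominators, with the negative parts moved to the other
    side so that all terms are natural numbers. *)
Definition code_rat_le x y :=
  int_pos (unpair1 x) * int_pos (unpair2 y) + int_neg (unpair1 y) * int_pos (unpair2 x)
  <= int_pos (unpair1 y) * int_pos (unpair2 x) + int_neg (unpair1 x) * int_pos (unpair2 y).

Definition bit s i := odd (iter i half s).

Lemma dec_bit m f g : computable m f -> computable m g ->
  decided m (fun v => bit (f v) (g v)).
Proof.
move=> hf hg; apply: dec_odd; apply: comp_iter => //.
by apply: comp_half; exact: comp_proj.
Qed.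

Ltac computability_codes := cbv beta; lazymatch goal with
  | |- computable _ (fun v => unpair1 _) => apply: comp_unpair1
  | |- computable _ (fun v => unpair2 _) => apply: comp_unpair2
  | |- computable _ (fun v => code_nth _ _) => apply: comp_code_nth
  | |- computable _ (fun v => nat_of_bool (bit _ _)) => apply: dec_bit
  | _ => computability
  end.

(* A set of states is a number below [2 ^ n] read in binary, a set of such sets a
   number below [2 ^ 2 ^ n].  Reachability is membership in all sets that contain
   the initial states and are closed under steps. *)
Definition bounded_reach n k (ini : nat -> bool) (step : nat -> nat -> nat -> bool) q :=
  ball (2 ^ n) (fun r =>
    (ball n (fun p => ini p ==> bit r p) &&
     ball n (fun p => ball k (fun a => ball n (fun p' =>
       bit r p && step p a p' ==> bit r p')))) ==> bit r q).

(** A greatest fixed point in the subset construction, witnessed by a family [F]: from each member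
    some letter leads, by safe transitions only, into another member. Sets of states are needed
    because one word must serve all runs at once. *)
Definition bounded_safe n k (step safe : nat -> nat -> nat -> bool) q :=
  bex (2 ^ 2 ^ n) (fun F =>
    bex (2 ^ n) (fun s => bit F s && bit s q) &&
    ball (2 ^ n) (fun s => bit F s ==>
      bex k (fun a => bex (2 ^ n) (fun s' => bit F s' &&
        ball n (fun p => ball n (fun p' =>
          bit s p && step p a p' ==> bit s' p' && safe p a p')))))).

Definition decision n k ini step safe :=
  bex n (fun q => bounded_reach n k ini step q && bounded_safe n k step safe q).

(** Tables are stored row by row, which gives the index in [entry]. Of the probabilities only the
    support is read: a non-negative rational is positive when the code of its numerator is
    nonzero. *)
Definition code_decision (above : bool) z :=
  let n := unpair1 (unpair1 z) in
  let k := unpair1 (unpair2 (unpair1 z)) in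
  let data := unpair2 (unpair2 (unpair1 z)) in
  let entry l p a p' := code_nth l ((p * k + a) * n + p') in
  decision n k
    (fun p => unpair1 (code_nth (unpair1 data) p) != 0)
    (fun p a p' => unpair1 (entry (unpair1 (unpair2 data)) p a p') != 0)
    (fun p a p' =>
       let le := code_rat_le (unpair2 z) (entry (unpair2 (unpair2 data)) p a p') in
       if above then le else ~~ le).

Lemma dec_code_decision above : decided 1 (fun v => code_decision above (nth 0 v 0)).
Proof.
rewrite /code_decision /decision /bounded_reach /bounded_safe /code_rat_le.
rewrite /int_pos /int_neg; cbv zeta.
case: above; do !computability_codes.
Qed.

(** * Codes of automata *)

(** Separates the diagonals of the Cantor pairing, so that a code determines the sum of its two
    components. *)
Lemma triangular_le s t : s < t -> (s * s.+1)./2 + s < (t * t.+1)./2.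
Proof.
elim: t => // t IH; rewrite ltnS leq_eqVlt => /orP[/eqP->|/IH] {IH}; nia.
Qed.

Lemma nat_pair_inj a b a' b' : nat_pair a b = nat_pair a' b' -> a = a' /\ b = b'.
Proof.
rewrite /nat_pair => e.
have [h|h|h] := ltngtP (a + b) (a' + b'); [| |by rewrite h in e; lia].
- by have := triangular_le h; lia.
- by have := triangular_le h; lia.
Qed.

Lemma nat_pair_ge a b : a <= nat_pair a b /\ b <= nat_pair a b.
Proof. rewrite /nat_pair; split; nia. Qed.

Lemma bsum_single B (F : nat -> nat) j : j < B ->
  (forall i, i != j -> F i = 0) -> bsum B F = F j.
Proof.
move=> jB F0; rewrite /bsum (bigD1_seq j) ?mem_index_iota ?iota_uniq //=.
by rewrite big1 // addn0.
Qed.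

(** Injectivity leaves a single nonzero term in the double sum, and [nat_pair_ge] places it within
    the search range. *)
Lemma unpair1K a b : unpair1 (nat_pair a b) = a.
Proof.
have [ha hb] := nat_pair_ge a b; rewrite /unpair1.
rewrite (@bsum_single _ _ a) // => [|i ia].
  rewrite (@bsum_single _ _ b) // => [|j jb]; first by rewrite eqxx muln1.
  case: eqP => [/nat_pair_inj[_ e]|_]; last by rewrite muln0.
  by rewrite e eqxx in jb.
rewrite /bsum big1 // => j _.
case: eqP => [/nat_pair_inj[e _]|_]; last by rewrite muln0.
by rewrite e eqxx in ia.
Qed.

Lemma unpair2K a b : unpair2 (nat_pair a b) = b.
Proof.
have [ha hb] := nat_pair_ge a b; rewrite /unpair2.
rewrite (@bsum_single _ _ a) // => [|i ia].
  rewrite (@bsum_single _ _ b) // => [|j jb]; first by rewrite eqxx muln1.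
  case: eqP => [/nat_pair_inj[_ e]|_]; last by rewrite muln0.
  by rewrite e eqxx in jb.
rewrite /bsum big1 // => j _.
case: eqP => [/nat_pair_inj[e _]|_]; last by rewrite muln0.
by rewrite e eqxx in ia.
Qed.

Lemma code_nthE s i : i < size s -> code_nth (enc_list s) i = nth 0 s i.
Proof.
rewrite /code_nth; elim: s i => [|x s IH] [|i] //= h; first by rewrite unpair1K.
by rewrite -iterS iterSr /code_tail /= unpair2K IH.
Qed.

Lemma enc_intE z : (int_pos (enc_int z) : int) = (z + int_neg (enc_int z))%R.
Proof.
case: z => m; rewrite /int_pos /int_neg /= odd_double ?uphalf_double ?doubleK.
  by rewrite mul1n mul0n addr0.
by rewrite mul1n mul0n NegzE addNr.
Qed.

Lemma enc_int_gt0 z : (0 < z)%R -> int_neg (enc_int z) = 0.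
Proof. by case: z => m // _; rewrite /int_neg /= odd_double mul0n. Qed.

Lemma code_rat_leE x y : code_rat_le (enc_rat x) (enc_rat y) = (x <= y)%R.
Proof.
rewrite /code_rat_le /enc_rat !unpair1K !unpair2K.
have -> : (x <= y)%R = (numq x * denq y <= numq y * denq x)%R by exact: le_ratE.
have := enc_intE (denq x); have := enc_intE (denq y).
rewrite !(enc_int_gt0 (denq_gt0 _)) !addr0.
move: (int_pos (enc_int (denq x))) (int_pos (enc_int (denq y))) => d e <- <-.
have := enc_intE (numq x); have := enc_intE (numq y).
move: (int_pos (enc_int (numq x))) (int_pos (enc_int (numq y))) => b a.
move: (int_neg (enc_int (numq x))) (int_neg (enc_int (numq y))) => b' a'.
move: (numq x) (numq y) => p q h1 h2.
have -> : p = (b%:Z - b'%:Z)%R by rewrite h2 addrK.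
have -> : q = (a%:Z - a'%:Z)%R by rewrite h1 addrK.
rewrite !mulrBl lerBlDr addrAC lerBrDr -!PoszM -!PoszD.
by rewrite lez_nat; lia.
Qed.

Lemma code_rat_pos x : (0 <= x)%R -> (unpair1 (enc_rat x) != 0) = (0 < x)%R.
Proof.
rewrite /enc_rat unpair1K -numq_gt0 -numq_ge0.
by case: (numq x) => m //= _; lia.
Qed.

Lemma size_flatten_uniform (T U : Type) (f : T -> seq U) c (s : seq T) :
  (forall x, size (f x) = c) -> size (flatten [seq f x | x <- s]) = size s * c.
Proof.
by move=> fc; elim: s => //= x s IH; rewrite size_cat fc IH mulSn.
Qed.

Lemma nth_flatten_uniform (T U : Type) (f : T -> seq U) c (s : seq T) x0 y0 i j :
  (forall x, size (f x) = c) -> i < size s -> j < c ->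
  nth y0 (flatten [seq f x | x <- s]) (i * c + j) = nth y0 (f (nth x0 s i)) j.
Proof.
move=> fc; elim: s i => [|x s IH] [|i] //= h jc; rewrite nth_cat fc.
  by rewrite mul0n add0n jc.
by rewrite mulSn -addnA ltnNge leq_addr /= addKn IH.
Qed.

(** Two nested uniform flattenings: blocks of length [k * n] for the states, each cut into blocks of
    length [n] for the letters. *)
Lemma code_nth_table n k (F : 'I_n -> 'I_k -> 'I_n -> nat) (p : 'I_n) (a : 'I_k) (p' : 'I_n) :
  code_nth (enc_list (flatten [seq flatten [seq [seq F q b q'
    | q' <- enum 'I_n] | b <- enum 'I_k] | q <- enum 'I_n])) ((p * k + a) * n + p')
  = F p a p'.
Proof.
have s1 q b : size [seq F q b q' | q' <- enum 'I_n] = n by rewrite size_map size_enum_ord.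
have s2 q : size (flatten [seq [seq F q b q' | q' <- enum 'I_n] | b <- enum 'I_k]) = k * n.
  by rewrite (@size_flatten_uniform _ _ _ n) ?size_enum_ord.
have e : (p * k + a) * n + p' = p * (k * n) + (a * n + p') by nia.
have l : a * n + p' < k * n by have := ltn_ord a; have := ltn_ord p'; nia.
rewrite code_nthE.
  rewrite e (@nth_flatten_uniform _ _ _ (k * n) _ p) ?size_enum_ord // nth_ord_enum.
  rewrite (@nth_flatten_uniform _ _ _ n _ a) ?size_enum_ord // nth_ord_enum.
  by rewrite (nth_map p) ?size_enum_ord // nth_ord_enum.
rewrite (@size_flatten_uniform _ _ _ (k * n)) ?size_enum_ord // e.
by have := ltn_ord p; nia.
Qed.

(** * The support graph *)

(** Binary expansion, least bit first: [P 0] is the last digit and the shifted predicate gives the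
    rest. *)
Lemma exists_code B (P : nat -> bool) :
  exists2 s, s < 2 ^ B & forall i, i < B -> bit s i = P i.
Proof.
elim: B P => [|B IH] P; first by exists 0.
have [s sB sP] := IH (fun i => P i.+1).
exists (P 0 + s.*2); first by rewrite expnS; case: (P 0); lia.
case=> [|i] iB; first by rewrite /bit /= oddD odd_double; case: (P 0).
by rewrite /bit iterSr half_bit_double; exact: sP.
Qed.

Section SupportGraph.
Context (n k : nat) (ini : 'I_n -> bool) (step safe : 'I_n -> 'I_k -> 'I_n -> bool).

Inductive reachable : 'I_n -> Prop :=
| reachable_ini p : ini p -> reachable p
| reachable_step p a p' : reachable p -> step p a p' -> reachable p'.

Fixpoint surely_safe (u : seq 'I_k) (p : 'I_n) : bool :=
  if u is a :: u' then [forall p', step p a p' ==> safe p a p' && surely_safe u' p']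
  else true.

Lemma surely_safe_prefix u v p : surely_safe (u ++ v) p -> surely_safe u p.
Proof.
elim: u p => //= a u IH p /forallP h; apply/forallP => p'.
by move/implyP: (h p') => {}h; apply/implyP => /h/andP[-> /IH].
Qed.

Context (ini' : nat -> bool) (step' safe' : nat -> nat -> nat -> bool).
Hypothesis iniE : forall p : 'I_n, ini' p = ini p.
Hypothesis stepE : forall (p : 'I_n) (a : 'I_k) (p' : 'I_n), step' p a p' = step p a p'.
Hypothesis safeE : forall (p : 'I_n) (a : 'I_k) (p' : 'I_n), safe' p a p' = safe p a p'.

(** From left to right, [r] is taken to be the code of the reachable set itself; the converse is
    induction on reachability. *)
Lemma bounded_reachP (q : 'I_n) : bounded_reach n k ini' step' q <-> reachable q.
Proof.
split=> [/ballP h|rq].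
  have [r rn rP] := exists_code n (fun i => `[< exists2 p : 'I_n, val p = i & reachable p >]).
  have rE (p : 'I_n) : bit r p <-> reachable p.
    rewrite rP //; split => [/asboolP[p1 /val_inj->]//|h1].
    by apply/asboolP; exists p.
  apply/rE; apply: (implyP (h r rn)); apply/andP; split.
    apply/ballP => p pn; apply/implyP => ip; apply/(rE (Ordinal pn)).
    by apply: reachable_ini; rewrite -iniE.
  apply/ballP => p pn; apply/ballP => a ak; apply/ballP => p' pn'.
  apply/implyP => /andP[/(rE (Ordinal pn)) bp st]; apply/(rE (Ordinal pn')).
  by apply: (reachable_step (a := Ordinal ak) bp); rewrite -stepE.
apply/ballP => r rn; apply/implyP => /andP[/ballP h0 /ballP h1].
elim: rq => [p ip|p a p' _ rp st].
  by have := h0 p (ltn_ord p); rewrite iniE ip.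
have /ballP/(_ a (ltn_ord a))/ballP/(_ p' (ltn_ord p')) := h1 p (ltn_ord p).
by rewrite rp stepE st.
Qed.

(** Choosing for each member of [F] a letter and a successor member, then iterating from [s0],
    spells out the word. *)
Lemma bounded_safe_sound (q : 'I_n) : bounded_safe n k step' safe' q ->
  exists w : nat -> 'I_k, forall l, surely_safe (mkseq w l) q.
Proof.
case/bexP => F _ /andP[/bexP[s0 s0n /andP[Fs0 s0q]] /ballP hF].
(* Choice needs a value for every [s], also outside [F]; the default letter is the one that [hF]
   provides at [s0], as nothing else shows the alphabet to be nonempty. *)
have next s : exists x : 'I_k * nat, s < 2 ^ n -> bit F s ->
    [/\ x.2 < 2 ^ n, bit F x.2 & forall p p' : 'I_n,
       bit s p -> step p x.1 p' -> bit x.2 p' /\ safe p x.1 p'].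
  have [sn|] := boolP (s < 2 ^ n); last first.
    by have /implyP/(_ Fs0)/bexP[a ak _] := hF s0 s0n; exists (Ordinal ak, 0).
  have [Fs|] := boolP (bit F s); last first.
    by have /implyP/(_ Fs0)/bexP[a ak _] := hF s0 s0n; exists (Ordinal ak, 0).
  have /implyP/(_ Fs)/bexP[a ak /bexP[s' sn' /andP[Fs' h]]] := hF s sn.
  exists (Ordinal ak, s') => _ _; split => // p p' sp st.
  have /ballP/(_ p' (ltn_ord p'))/implyP := ballP _ _ h p (ltn_ord p).
  rewrite (stepE p (Ordinal ak)) (safeE p (Ordinal ak)) sp.
  by case/(_ st)/andP.
have [f fP] := choice next.
pose S := prec s0 (fun _ s => (f s).2).
have SP i : S i < 2 ^ n /\ bit F (S i).
  by elim: i => [//|i [h1 h2]]; have [] := fP _ h1 h2.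
exists (fun i => (f (S i)).1) => l.
suff: forall i (p : 'I_n), bit (S i) p -> surely_safe [seq (f (S j)).1 | j <- iota i l] p by exact.
elim: l => //= l IH i p Sp; apply/forallP => p'; apply/implyP => st.
have [h1 h2] := SP i; have [_ _ /(_ _ _ Sp st)[h3 ->]] := fP _ h1 h2.
exact: IH.
Qed.

Lemma bounded_safe_complete (q : 'I_n) :
  (forall m, exists2 u, size u = m & surely_safe u q) -> bounded_safe n k step' safe' q.
Proof.
move=> hq.
(* The family of those sets that, for every [m], survive some common word of
   length [m] is closed: were every letter a to fail at some depth m_a, then no
   word of length [1 + max m_a] would survive. *)
pose good (S : 'I_n -> bool) :=
  forall m, exists2 u, size u = m & forall p, S p -> surely_safe u p.
have [F Fn FP] := exists_code (2 ^ n) (fun s => `[< good (fun p => bit s p) >]).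
have FE s : s < 2 ^ n -> bit F s <-> good (fun p => bit s p).
  by move=> sn; rewrite FP //; split => /asboolP.
apply/bexP; exists F => //; apply/andP; split.
  have [s sn sP] := exists_code n (fun i => i == q).
  apply/bexP; exists s => //; rewrite sP // eqxx andbT; apply/FE => // m.
  have [u um uq] := hq m; exists u => // p; rewrite sP // => /eqP/val_inj-> //.
apply/ballP => s sn; apply/implyP => /FE => /(_ sn) gs.
have [post postn postP] : exists2 t : 'I_k -> nat, (forall a, t a < 2 ^ n) &
    forall a (p' : 'I_n), bit (t a) p' = [exists p : 'I_n, bit s p && step p a p'].
  have /choice[t tP] : forall a, exists t, t < 2 ^ n /\ forall p' : 'I_n,
      bit t p' = [exists p : 'I_n, bit s p && step p a p'].
    move=> a; have [t tn tP] := exists_code n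
      (fun i => [exists p : 'I_n, [exists p' : 'I_n, (val p' == i) && (bit s p && step p a p')]]).
    exists t; split => // p'; rewrite tP //; apply: eq_existsb => p.
    apply/existsP/idP => [[x /andP[/eqP/val_inj->]]//|h]; by exists p'; rewrite eqxx.
  by exists t => a; have [] := tP a.
suff [a sa ga] : exists2 a : 'I_k,
    (forall p p' : 'I_n, bit s p -> step p a p' -> safe p a p') & good (fun p => bit (post a) p).
  apply/bexP; exists a => //; apply/bexP; exists (post a) => //.
  apply/andP; split; first exact/FE.
  apply/ballP => p pn; apply/ballP => p' pn'; apply/implyP.
  rewrite (stepE (Ordinal pn) a (Ordinal pn')) (safeE (Ordinal pn) a (Ordinal pn')).
  move=> /andP[sp st]; rewrite (postP a (Ordinal pn')) (sa (Ordinal pn) _ sp) // andbT.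
  by apply/existsP; exists (Ordinal pn); rewrite st andbT.
apply: contrapT => no.
have /choice[d dP] : forall a : 'I_k, exists m, forall u, size u = m ->
    ~ forall p : 'I_n, bit s p -> surely_safe (a :: u) p.
  move=> a; apply: contrapT => h; apply: no; exists a.
    (* A letter with an unsafe transition out of [s] fails at depth 0 already. *)
    move=> p p' sp st; apply: contrapT => us; apply: h; exists 0 => u _ /(_ p sp)/forallP/(_ p').
    by rewrite st /= => /andP[].
  move=> m; apply: contrapT => hm; apply: h; exists m => u um us; apply: hm.
  exists u => // p'; rewrite postP => /existsP[p /andP[sp st]].
  by have /forallP/(_ p') := us p sp; rewrite st => /andP[].
have [[|a u] //] := gs (\max_a d a).+1.
move=> [sz] us; apply: (dP a (take (d a) u)).
  by rewrite size_take_min sz; apply/minn_idPl; exact: leq_bigmax.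
move=> p sp; apply: (@surely_safe_prefix _ (drop (d a) u)).
by rewrite /= cat_take_drop; exact: us.
Qed.

Lemma decision_sound : decision n k ini' step' safe' ->
  exists2 q, reachable q &
    exists w : nat -> 'I_k, forall l, surely_safe (mkseq w l) q.
Proof.
case/bexP => q qn /andP[hr hs]; exists (Ordinal qn); first exact/bounded_reachP.
exact: (@bounded_safe_sound (Ordinal qn)).
Qed.

(** Each reachable state has a length at which every word fails. Failure persists under extension of
    the word, so the maximum over the finitely many states serves them all. *)
Lemma decision_complete : ~~ decision n k ini' step' safe' ->
  exists m, forall q u, reachable q -> size u = m -> ~~ surely_safe u q.
Proof.
move=> nd; have /choice[d dP] : forall q, exists m, forall u,
    reachable q -> size u = m -> ~~ surely_safe u q.
  move=> q; apply: contrapT => h; move/negP: nd; apply; apply/bexP; exists q => //.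
  apply/andP; split; first apply/bounded_reachP; first apply: contrapT => nr.
    (* An unreachable [q] meets the requirement vacuously. *)
    by apply: h; exists 0.
  apply: bounded_safe_complete => m; apply: contrapT => hm; apply: h; exists m.
  by move=> u _ um; apply/negP => us; apply: hm; exists u.
exists (\max_q d q) => q u rq um.
have : ~~ surely_safe (take (d q) u) q.
  by apply: dP => //; rewrite size_take_min um; apply/minn_idPl; exact: leq_bigmax.
by apply: contra; rewrite -{1}(cat_take_drop (d q) u) => /surely_safe_prefix.
Qed.

End SupportGraph.

(** * Probability of staying safe *)

Local Open Scope classical_set_scope.
Local Open Scope ring_scope.

Section SafeMass.
Context (R : realType) (n k : nat).
Context (ini : 'I_n -> R) (D : 'I_n -> 'I_k -> 'I_n -> R).
Context (safe : 'I_n -> 'I_k -> 'I_n -> bool).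
Hypothesis D_ge0 : forall p a p', 0 <= D p a p'.
Hypothesis D_sum1 : forall p a, \sum_p' D p a p' = 1.

Let pos p a p' := 0 < D p a p'.
Let reach := reachable (fun p => 0 < ini p) pos.

(** The probability that a run from [p] over [u] takes safe transitions only, by conditioning on the
    first step. *)
Fixpoint safe_mass (u : seq 'I_k) (p : 'I_n) : R :=
  if u is a :: u' then \sum_p' D p a p' * ((safe p a p')%:R * safe_mass u' p') else 1.

Lemma safe_mass_le1 u p : safe_mass u p <= 1.
Proof.
elim: u p => //= a u IH p; rewrite -[leRHS](D_sum1 p a); apply: ler_sum => p' _.
by rewrite ler_piMr //; case: (safe p a p'); rewrite ?mul1r ?mul0r ?ler01.
Qed.

(** The defect [1 - safe_mass u p] is a sum of non-negative terms, hence zero only if each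
    transition of positive probability is safe and leads to a state without defect. *)
Lemma safe_mass_eq1 u p : (safe_mass u p == 1) = surely_safe pos safe u p.
Proof.
elim: u p => [|a u IH] p; first by rewrite eqxx.
have -> : surely_safe pos safe (a :: u) p =
    [forall p', D p a p' * (1 - (safe p a p')%:R * safe_mass u p') == 0].
  apply: eq_forallb => p'; rewrite -/(surely_safe pos safe u p') -IH.
  rewrite mulf_eq0 subr_eq0 /pos lt_def D_ge0 andbT; case: (D p a p' == 0) => //=.
  by case: (safe p a p'); rewrite ?mul1r ?mul0r ?oner_eq0 // eq_sym.
have e : 1 - safe_mass (a :: u) p =
    \sum_p' D p a p' * (1 - (safe p a p')%:R * safe_mass u p').
  rewrite -[X in X - _ = _](D_sum1 p a) /= -sumrB; apply: eq_bigr => p' _.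
  by rewrite mulrBr mulr1.
rewrite eq_sym -subr_eq0 e psumr_eq0.
  by apply/allP/forallP => h p'; have := h p' => //; apply; rewrite mem_index_enum.
move=> p' _; rewrite mulr_ge0 // subr_ge0.
by case: (safe p a p'); rewrite ?mul1r ?mul0r ?safe_mass_le1 ?ler01.
Qed.

(** Markov property: after [u] the run is in a reachable state, where the bound on [v] applies.
    Transitions of probability zero are split off, since they may leave [reach]. *)
Lemma safe_mass_cat c u v p : reach p -> (forall p', reach p' -> safe_mass v p' <= c) ->
  safe_mass (u ++ v) p <= safe_mass u p * c.
Proof.
move=> + vc; elim: u p => [|a u IH] p rp /=; first by rewrite mul1r vc.
rewrite mulr_suml; apply: ler_sum => p' _.
have [D0|Dn0] := eqVneq (D p a p') 0; first by rewrite D0 !mul0r.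
rewrite -!mulrA ler_wpM2l // ler_wpM2l // IH //.
by apply: (reachable_step (a := a) rp); rewrite /pos lt_def Dn0 D_ge0.
Qed.

(** The maximum is taken over finitely many pairs of a reachable state and a word of length [m],
    each of mass below 1; the default 0 keeps [c] non-negative. *)
Lemma safe_mass_unif m :
  (forall q u, reach q -> size u = m -> ~~ surely_safe pos safe u q) ->
  exists2 c, 0 <= c < 1 & forall q u, reach q -> size u = m -> safe_mass u q <= c.
Proof.
move=> h; pose X := ('I_n * m.-tuple 'I_k)%type.
pose c := \big[Num.max/0]_(x : X | `[< reach x.1 >]) safe_mass x.2 x.1.
exists c => [|q u rq um].
  apply/andP; split; first exact: bigmax_ge_id.
  apply: bigmax_lt => // -[q u] /= /asboolP rq.
  by rewrite lt_neqAle safe_mass_le1 andbT safe_mass_eq1 h // size_tuple.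
have /eqP um' := um.
have := @le_bigmax_cond _ _ X 0 (q, Tuple um') (fun x => `[< reach x.1 >])
  (fun x => safe_mass x.2 x.1).
by apply; exact/asboolP.
Qed.

Lemma safe_mass_exp m c : 0 <= c ->
  (forall q u, reach q -> size u = m -> safe_mass u q <= c) ->
  forall j q u, reach q -> size u = (j * m)%N -> safe_mass u q <= c ^+ j.
Proof.
move=> c0 h; elim=> [|j IH] q u rq us.
  by rewrite expr0 safe_mass_le1.
rewrite -(cat_take_drop m u) exprS.
have s1 : size (take m u) = m by rewrite size_take_min us; nia.
have s2 : size (drop m u) = (j * m)%N by rewrite size_drop us; nia.
apply: le_trans (safe_mass_cat (c := c ^+ j) _ rq _) _ => [p' rp'|].
  exact: IH.
by rewrite ler_wpM2r ?exprn_ge0 // h.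
Qed.

(** * Probabilities of run prefixes *)

Definition run_prob (w : nat -> 'I_k) m (r : nat -> 'I_n) : R :=
  ini (r 0%N) * \prod_(i < m) D (r i) (w i) (r i.+1).

Definition extend (r : nat -> 'I_n) m q : nat -> 'I_n :=
  fun i => if (i <= m)%N then r i else q.

Lemma run_prob_extend w m r q :
  run_prob w m.+1 (extend r m q) = run_prob w m r * D (r m) (w m) q.
Proof.
rewrite /run_prob big_ord_recr /= -mulrA /extend leqnn ltnn; congr (_ * (_ * _)).
by apply: eq_bigr => i _; rewrite ltn_ord (ltnW (ltn_ord i)).
Qed.

Hypothesis ini_ge0 : forall p, 0 <= ini p.

Lemma run_prob_ge0 w m r : 0 <= run_prob w m r.
Proof. by rewrite mulr_ge0 // prodr_ge0. Qed.

Lemma run_prob_reach w m r : run_prob w m r != 0 -> reach (r m).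
Proof.
elim: m => [|m IH].
  rewrite /run_prob big_ord0 mulr1 => h; apply: reachable_ini.
  by rewrite lt_def h ini_ge0.
rewrite /run_prob big_ord_recr mulrA mulf_eq0 negb_or => /andP[/IH h1 h2].
by apply: (reachable_step (a := w m) h1); rewrite /pos lt_def h2 D_ge0.
Qed.

(** The tail [v] is universally quantified so that, in the step case, the predecessor can be reached
    with the tail [a] followed by [v]. *)
Lemma reach_run q (v : nat -> 'I_k) : reach q ->
  exists w t r, [/\ forall i, w (t + i)%N = v i, r t = q & 0 < run_prob w t r].
Proof.
move=> rq; elim: rq v => [p ip|p a p' _ IH st] v.
  by exists v, 0%N, (fun=> p); split => //; rewrite /run_prob big_ord0 mulr1.
have [w [t [r [wt rt pr]]]] := IH (fun i => if i is j.+1 then v j else a).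
exists w, t.+1, (extend r t p'); split => [i||].
- by rewrite addSnnS wt.
- by rewrite /extend ltnn.
- by rewrite run_prob_extend mulr_gt0 // rt -[t in w t]addn0 wt.
Qed.

End SafeMass.

(** * Eventually safe runs *)

HB.instance Definition _ n := isPointed.Build 'I_n.+1 ord0.

(** Cylinders presented by an infinite sequence, which avoids reindexing functions on ordinals when
    [m] grows. *)
Definition prefix_set n m (r : nat -> 'I_n) : set (nat -> 'I_n) :=
  [set r' | forall i, (i <= m)%N -> r' i = r i].

Lemma prefix_setE n m (r : nat -> 'I_n) :
  prefix_set m r = cylinder (fun i : 'I_m.+1 => r i).
Proof.
apply/seteqP; split => r' h; first by move=> i; apply: h; rewrite -ltnS.
by move=> i im; have := h (Ordinal (im : (i < m.+1)%N)).
Qed.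

Lemma cylinderE n m (f : 'I_m.+1 -> 'I_n) :
  cylinder f = prefix_set m (fun i => f (inord i)).
Proof.
rewrite prefix_setE; congr cylinder; apply/funext => i.
by rewrite inord_val.
Qed.

Section CoBuchi.
Context (R : realType) (n0 k : nat).
Local Notation n := n0.+1.
Context (ini : 'I_n -> R) (D : 'I_n -> 'I_k -> 'I_n -> R).
Context (safe : 'I_n -> 'I_k -> 'I_n -> bool).
Hypothesis ini_ge0 : forall p, 0 <= ini p.
Hypothesis D_ge0 : forall p a p', 0 <= D p a p'.
Hypothesis D_sum1 : forall p a, \sum_p' D p a p' = 1.

Local Notation T := (g_sigma_algebraType (@cylinders n)).
Context (w : nat -> 'I_k) (P : {measure set T -> \bar R}).
Hypothesis P_prefix : forall m r, P (prefix_set m r) = (run_prob ini D w m r)%:E.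

Definition safe_window t l : set (nat -> 'I_n) :=
  [set r | forall i, (t <= i < t + l)%N -> safe (r i) (w i) (r i.+1)].

Definition safe_from t : set (nat -> 'I_n) :=
  [set r | forall i, (t <= i)%N -> safe (r i) (w i) (r i.+1)].

Definition coBuchi : set (nat -> 'I_n) := \bigcup_t safe_from t.

Lemma measurable_prefix m r : measurable (prefix_set m r : set T).
Proof.
apply: sub_sigma_algebra; exists m, (fun i : 'I_m.+1 => r i).
exact: prefix_setE.
Qed.

Lemma prefix_cover m :
  setT = \big[setU/set0]_(f : {ffun 'I_m.+1 -> 'I_n}) prefix_set m (fun i => f (inord i)).
Proof.
rewrite -bigcup_seq; apply/seteqP; split => // r _.
exists [ffun i : 'I_m.+1 => r i]; first by rewrite /= mem_index_enum.
by move=> i im; rewrite ffunE inordK.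
Qed.

(** Splits by the state at time [t.+1], matching the recursion of [safe_mass]; this is the induction
    step of [measure_window]. *)
Lemma window_split t l r :
  prefix_set t r `&` safe_window t l.+1 =
  \big[setU/set0]_(q < n | safe (r t) (w t) q)
     (prefix_set t.+1 (extend r t q) `&` safe_window t.+1 l).
Proof.
rewrite -bigcup_seq_cond; apply/seteqP; split => [r' [h s]|r' [q /= /andP[_ sq] [h s]]].
  exists (r' t.+1); rewrite /= ?mem_index_enum.
    by rewrite -(h t (leqnn _)); apply: s; rewrite leqnn addnS ltnS leq_addr.
  split=> [i|i /andP[ti il]].
    rewrite leq_eqVlt /extend => /orP[/eqP->|im]; first by rewrite ltnn.
    by rewrite -ltnS im h.
  by apply: s; rewrite (ltnW ti) addnS -addSn.
split=> [i im|i /andP[]]; first by rewrite h ?(leq_trans im) // /extend im.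
rewrite leq_eqVlt => /orP[/eqP<- _|ti il]; last by apply: s; rewrite ti addSn -addnS.
by rewrite !h // /extend leqnn ltnn.
Qed.

Lemma measurable_window t l : measurable (safe_window t l : set T).
Proof.
(* Safety of the transition at time [i] depends on the first [i.+2] states only, so the event is a
   finite union of cylinders. *)
have mS i : measurable ([set r : T | safe (r i) (w i) (r i.+1)]).
  rewrite [X in measurable X](_ : _ = \big[setU/set0]_(f : {ffun 'I_i.+2 -> 'I_n} |
    safe (f (inord i)) (w i) (f (inord i.+1))) prefix_set i.+1 (fun j => f (inord j))).
    by apply: bigsetU_measurable => f _; exact: measurable_prefix.
  rewrite -bigcup_seq_cond; apply/seteqP; split => [r h|r [f /= /andP[_ sf] h]].
    exists [ffun j : 'I_i.+2 => r j]; last by move=> j ji; rewrite ffunE inordK.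
    by rewrite /= mem_index_enum !ffunE !inordK.
  by rewrite !h.
rewrite (_ : safe_window t l = \bigcap_(i in [set i | (t <= i < t + l)%N])
   [set r | safe (r i) (w i) (r i.+1)]) //.
exact: bigcap_measurableType.
Qed.

Lemma measurable_safe_from t : measurable (safe_from t : set T).
Proof.
rewrite (_ : safe_from t = \bigcap_l safe_window t l).
  by apply: bigcap_measurableType => l _; exact: measurable_window.
apply/seteqP; split => [r h l _ i /andP[ti _]|r h i ti]; first exact: h.
by apply: (h i.+1 I); rewrite ti addnS ltnS leq_addl.
Qed.

Lemma measurable_coBuchi : measurable (coBuchi : set T).
Proof. by apply: bigcup_measurable => t _; exact: measurable_safe_from. Qed.

Lemma measure_window t l r :
  P (prefix_set t r `&` safe_window t l) =
  (run_prob ini D w t r * safe_mass D safe [seq w i | i <- iota t l] (r t))%:E.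
Proof.
elim: l t r => [|l IH] t r.
  rewrite (_ : safe_window t 0 = setT) ?setIT ?P_prefix ?mulr1 //.
  by apply/seteqP; split => // r' _ i; rewrite addn0; lia.
rewrite window_split measure_bigsetU_ord_cond.
- rewrite (eq_bigr (fun q => (run_prob ini D w t r * (D (r t) (w t) q *
      safe_mass D safe [seq w i | i <- iota t.+1 l] q))%:E)); last first.
    by move=> q _; rewrite [LHS]IH run_prob_extend /extend ltnn mulrA.
  rewrite sumEFin -mulr_sumr /= big_mkcond /=; congr (_ * _)%:E.
  by apply: eq_bigr => q _; case: ifP; rewrite ?mul1r ?mul0r ?mulr0.
- move=> q _; apply: measurableI; [exact: measurable_prefix|exact: measurable_window].
- move=> q q' _ _ [r' [[h _] [h' _]]].
  by have := h t.+1 (leqnn _); rewrite h' // /extend ltnn.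
Qed.

(** A countable union over [t], and for each [t] a finite union over prefixes, of sets that must be
    null. Each lies in windows of length [j * m], whose mass is at most a constant times
    [c ^+ j]. *)
Lemma coBuchi_null m :
  (forall q u, reachable (fun p => 0 < ini p) (fun p a p' => 0 < D p a p') q ->
     size u = m -> ~~ surely_safe (fun p a p' => 0 < D p a p') safe u q) ->
  P coBuchi = 0%E.
Proof.
move=> /(safe_mass_unif D_ge0 D_sum1)[c /andP[c0 c1] cP].
apply: measure_negligible; first exact: measurable_coBuchi.
apply: negligible_bigcup => t.
rewrite -[safe_from t]setTI (prefix_cover t) big_distrl /=.
elim/big_ind: _ => [||f _]; [exact: negligible_set0|move=> x y hx hy;  exact: (negligibleU hx hy)|].
move: (fun i => f (inord i)) => r {f}.
have mI : measurable (prefix_set t r `&` safe_from t : set T).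
  by apply: measurableI; [exact: measurable_prefix|exact: measurable_safe_from].
apply/negligibleP => //.
have le_c j : (P (prefix_set t r `&` safe_from t) <= (run_prob ini D w t r * c ^+ j)%:E)%E.
  apply: (@le_trans _ _ (P (prefix_set t r `&` safe_window t (j * m)))).
    rewrite le_measure ?inE //.
      by apply: measurableI; [exact: measurable_prefix|exact: measurable_window].
    by apply: setIS => r' h i /andP[ti _]; exact: h.
  rewrite measure_window lee_fin.
  (* A prefix of probability zero may end in an unreachable state, to which [cP] does not apply. *)
  have [->|/run_prob_reach rr] := eqVneq (run_prob ini D w t r) 0; first by rewrite !mul0r.
  rewrite ler_wpM2l ?run_prob_ge0 //.
  apply: (safe_mass_exp D_ge0 D_sum1 c0 cP); last by rewrite size_map size_iota.
  exact: rr.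
apply/eqP; rewrite eq_le measure_ge0 andbT.
have cvg0 : (fun j => (run_prob ini D w t r * c ^+ j)%:E : \bar R) @ \oo --> (0 : R)%:E.
  apply: cvg_EFin; first exact: nearW.
  by apply: cvg_geometric; rewrite ger0_norm.
rewrite -[leRHS]/(0%:E) -(cvg_lim (@ereal_hausdorff R) cvg0).
by apply: lime_ge; [exact: cvgP cvg0|exact: nearW].
Qed.

(** Sure safety makes every window after the prefix have the full mass of the prefix; continuity
    from above passes this to their intersection. *)
Lemma coBuchi_pos t r : 0 < run_prob ini D w t r ->
  (forall l, surely_safe (fun p a p' => 0 < D p a p') safe [seq w i | i <- iota t l] (r t)) ->
  (0 < P coBuchi)%E.
Proof.
move=> p0 ss; pose F l := prefix_set t r `&` safe_window t l.
have mF l : measurable (F l : set T).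
  by apply: measurableI; [exact: measurable_prefix|exact: measurable_window].
have PF l : P (F l) = (run_prob ini D w t r)%:E.
  rewrite measure_window; have := ss l.
  by rewrite -(safe_mass_eq1 safe D_ge0 D_sum1) => /eqP->; rewrite mulr1.
have mcF : measurable (\bigcap_l F l : set T) by exact: bigcap_measurableType.
have : P \o F @ \oo --> P (\bigcap_l F l).
  apply: nonincreasing_cvg_mu => //; first by rewrite [ltLHS]PF ltry.
  move=> a b ab; apply/subsetPset; apply: setIS => r' h i /andP[ti il].
  by apply: h; rewrite ti (leq_trans il) // leq_add2l.
rewrite (_ : P \o F = cst (run_prob ini D w t r)%:E); last exact/funext.
move=> /cvg_lim PcF; have {}PcF : P (\bigcap_l F l) = (run_prob ini D w t r)%:E.
  by rewrite -PcF // lim_cst.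
apply: (@lt_le_trans _ _ (P (\bigcap_l F l))); first by rewrite PcF lte_fin.
rewrite le_measure ?inE //; first exact: measurable_coBuchi.
move=> r' h; exists t => // i ti; have [_] := h i.+1 I; apply.
by rewrite ti addnS ltnS leq_addl.
Qed.

End CoBuchi.

(** * Existence of the measure on runs *)

Section RunMeasureExistence.
Context (R : realType) (n0 k : nat).
Local Notation n := n0.+1.

Definition cumul (d : 'I_n -> R) (i : nat) : R := \sum_(p < n | (p < i)%N) d p.

Lemma cumul0 d : cumul d 0 = 0.
Proof. by rewrite /cumul big_pred0. Qed.

Lemma cumulS d (q : 'I_n) : cumul d q.+1 = cumul d q + d q.
Proof.
rewrite /cumul (bigD1 q) //= addrC; congr (_ + _); apply: eq_bigl => p.
by rewrite ltnS leq_eqVlt -val_eqE /=; case: ltngtP.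
Qed.

Lemma cumul_full d : cumul d n = \sum_p d p.
Proof. by apply: eq_bigl => p; rewrite ltn_ord. Qed.

Lemma le_cumul d i j : (forall p, 0 <= d p) -> (i <= j)%N -> cumul d i <= cumul d j.
Proof.
move=> d0 ij; rewrite /cumul [leRHS](bigID (fun p : 'I_n => (p < i)%N)) /=.
rewrite [X in _ <= X + _](eq_bigl (fun p : 'I_n => (p < i)%N)) ?lerDl ?sumr_ge0 //.
by move=> p; case: (ltnP p i) => pi; rewrite ?andbF ?andbT // (leq_trans pi).
Qed.

(** For a distribution [d], the interval from [c] to [c + b] is cut proportionally to [d]; half-open
    pieces make this a partition. *)
Definition slot (c b : R) (d : 'I_n -> R) (q : 'I_n) (x : R) : bool :=
  c + b * cumul d q <= x < c + b * cumul d q + b * d q.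

Lemma slot_exists c b d x : \sum_p d p = 1 -> c <= x < c + b -> exists q, slot c b d q x.
Proof.
move=> d1 /andP[cx xb]; pose f i := c + b * cumul d i.
have f0 : f 0%N <= x by rewrite /f cumul0 mulr0 addr0.
have fn : x < f n by rewrite /f cumul_full d1 mulr1.
suff [i iN] : exists2 i, (i < n)%N & f i <= x < f i.+1.
  move=> h; exists (Ordinal iN); move: h; rewrite /slot /f.
  by rewrite (cumulS d (Ordinal iN)) mulrDr addrA.
(* Only the upper index with [x < f m] decreases, while the bound [n] of the goal stays; the descent
   stops at the first [m] with [f m <= x]. *)
elim: {1 3}n (leqnn n) fn => [|m IH] mn xm; first by rewrite ltNge f0 in xm.
have [h|h] := ltP x (f m); last by exists m => //; rewrite h.
have [|i im] := IH (ltnW mn); first by [].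
by exists i => //; exact: ltnW.
Qed.

(** Applied twice with [q] and [q'] exchanged, it shows that a point lies in one slot only. *)
Lemma slot_lt c b d q q' x : 0 <= b -> (forall p, 0 <= d p) ->
  slot c b d q x -> slot c b d q' x -> (q' <= q)%N.
Proof.
move=> b0 d0 /andP[_ h1] /andP[h2 _]; rewrite leqNgt; apply/negP => qq.
have := le_lt_trans h2 h1; rewrite -addrA -mulrDr -cumulS ltNge lerD2l.
by rewrite ler_wpM2l // le_cumul.
Qed.

Context (ini : 'I_n -> R) (D : 'I_n -> 'I_k -> 'I_n -> R).
Hypothesis ini_ge0 : forall p, 0 <= ini p.
Hypothesis ini_sum1 : \sum_p ini p = 1.
Hypothesis D_ge0 : forall p a p', 0 <= D p a p'.
Hypothesis D_sum1 : forall p a, \sum_p' D p a p' = 1.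
Context (w : nat -> 'I_k).

Local Notation prob := (run_prob ini D w).

(* The prefixes of length [m] cut [0, 1) into consecutive intervals of length
   [prob m r], those of length [m + 1] refining those of length [m]. *)
Fixpoint left_end m (r : nat -> 'I_n) : R :=
  if m is m'.+1 then left_end m' r + prob m' r * cumul (D (r m') (w m')) (r m)
  else cumul ini (r 0%N).

Definition inside m r x := left_end m r <= x < left_end m r + prob m r.

Lemma inside0 r x : inside 0 r x = slot 0 1 ini (r 0%N) x.
Proof. by rewrite /inside /slot /run_prob /= big_ord0 !mul1r mulr1 !add0r. Qed.

Lemma insideS m r x :
  inside m.+1 r x = slot (left_end m r) (prob m r) (D (r m) (w m)) (r m.+1) x.
Proof. by rewrite /inside /slot /= /run_prob big_ord_recr mulrA. Qed.

Lemma eq_prob m r r' : (forall i, (i <= m)%N -> r i = r' i) -> prob m r = prob m r'.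
Proof.
move=> h; rewrite /run_prob h //; congr (_ * _); apply: eq_bigr => i _.
by rewrite !h // ltnW.
Qed.

Lemma eq_left_end m r r' :
  (forall i, (i <= m)%N -> r i = r' i) -> left_end m r = left_end m r'.
Proof.
elim: m => [|m IH] h /=; first by rewrite h.
have h' i : (i <= m)%N -> r i = r' i by move=> im; rewrite h // (leq_trans im).
by rewrite (IH h') (eq_prob h') !h.
Qed.

Lemma eq_inside m r r' x :
  (forall i, (i <= m)%N -> r i = r' i) -> inside m r x = inside m r' x.
Proof. by move=> h; rewrite /inside (eq_left_end h) (eq_prob h). Qed.

Lemma slot_sub c b d q x : 0 <= b -> (forall p, 0 <= d p) -> \sum_p d p = 1 ->
  slot c b d q x -> c <= x < c + b.
Proof.
move=> b0 d0 d1 /andP[h1 h2]; apply/andP; split.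
  apply: le_trans h1; rewrite lerDl mulr_ge0 // -(cumul0 d); exact: le_cumul.
apply: lt_le_trans h2 _; rewrite -addrA -mulrDr -cumulS lerD2l ler_piMr //.
by rewrite -d1 -cumul_full le_cumul.
Qed.

Lemma inside_pred m r x : inside m.+1 r x -> inside m r x.
Proof. by rewrite insideS => /slot_sub; apply => //; exact: run_prob_ge0. Qed.

Lemma inside_unit m r x : inside m r x -> 0 <= x < 1.
Proof.
elim: m => [|m IH]; last by move/inside_pred.
by rewrite inside0 => /slot_sub; rewrite add0r; apply.
Qed.

(** The prefix whose interval contains [x] is extended one state at a time. *)
Lemma run_exists x : 0 <= x < 1 -> exists r, forall m, inside m r x.
Proof.
move=> x01; have [q0 q0P] : exists q, slot 0 1 ini q x.
  by apply: slot_exists; rewrite ?add0r.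
have /choice[g gP] : forall mr : nat * (nat -> 'I_n), exists q,
    inside mr.1 mr.2 x -> inside mr.1.+1 (extend mr.2 mr.1 q) x.
  move=> [m r] /=; have [h|] := boolP (inside m r x); last by exists ord0.
  have [q qP] := slot_exists (D_sum1 (r m) (w m)) h; exists q => _; rewrite insideS.
  have e i : (i <= m)%N -> extend r m q i = r i by rewrite /extend => ->.
  by rewrite (eq_left_end e) (eq_prob e) e // /extend ltnn.
pose rs := prec (fun=> q0) (fun m r => extend r m (g (m, r))).
have rsP m : inside m (rs m) x.
  elim: m => [|m IH]; first by rewrite inside0.
  exact: (gP (m, rs m) IH).
have rsE m j i : (i <= m)%N -> rs (m + j)%N i = rs m i.
  move=> im; elim: j => [|j IH]; first by rewrite addn0.
  by rewrite addnS /= /extend (leq_trans im) ?leq_addr.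
(* Diagonal limit: from stage [i] on, the entry at [i] no longer changes. *)
exists (fun i => rs i i) => m; rewrite (@eq_inside _ _ (rs m)) // => i im.
by rewrite -(subnKC im) rsE.
Qed.

Lemma inside_uniq m r r' x : inside m r x -> inside m r' x ->
  forall i, (i <= m)%N -> r i = r' i.
Proof.
have sl c b d q q' : 0 <= b -> (forall p, 0 <= d p) ->
    slot c b d q x -> slot c b d q' x -> q = q'.
  move=> b0 d0 h h'; apply/val_inj/eqP; rewrite eqn_leq.
  by rewrite (slot_lt b0 d0 h' h) (slot_lt b0 d0 h h').
elim: m => [|m IH] h h' i.
  by rewrite leqn0 => /eqP->; rewrite !inside0 in h h'; exact: sl h h'.
have {}IH := IH (inside_pred h) (inside_pred h').
rewrite leq_eqVlt ltnS => /orP[/eqP->|/IH//].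
rewrite !insideS -(eq_left_end IH) -(eq_prob IH) -IH // in h h'.
by apply: sl h h' => //; exact: run_prob_ge0.
Qed.

(** With [X] sending a point to its run, the preimage of a cylinder within [I] is exactly its
    interval, whose length is the required probability. [X] is arbitrary outside [I], hence the
    intersection in [pre]. *)
Lemma run_measure_exists : exists mu : set (nat -> 'I_n) -> \bar R,
  [/\ mu set0 = 0%E, (forall X, 0 <= mu X)%E,
      (forall F : nat -> set (nat -> 'I_n),
          (forall i, <<s @cylinders n >> (F i)) -> trivIset setT F ->
          mu (\bigcup_i F i) = (\sum_(i <oo) mu (F i))%E),
      mu setT = 1%E &
      forall m r, mu (prefix_set m r) = (prob m r)%:E].
Proof.
have /choice[X XP] : forall x, exists r, 0 <= x < 1 -> forall m, inside m r x.
  move=> x; have [/run_exists[r h]|] := boolP (0 <= x < 1); first by exists r.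
  by exists (fun=> ord0).
pose I : set (measurableTypeR R) := [set` `[0, 1[ ].
pose pre (S : set (nat -> 'I_n)) : set (measurableTypeR R) := I `&` X @^-1` S.
have pre_prefix m r : pre (prefix_set m r) = [set` `[left_end m r, left_end m r + prob m r[ ].
  apply/seteqP; split => x.
    rewrite /pre /I /= in_itv /= => -[x01 h]; rewrite in_itv /=.
    by rewrite -[_ && _]/(inside m r x) -(@eq_inside m (X x)) //; exact: XP.
  rewrite /= in_itv /= => h; have x01 := inside_unit h.
  split; first by rewrite /I /= in_itv.
  by apply: (@inside_uniq m) h; exact: XP.
have mI : measurable I by exact: measurable_itv.
have mpre S : <<s @cylinders n >> S -> measurable (pre S).
  (* The sets with measurable preimage form a sigma-algebra that contains the cylinders. *)
  apply: (@smallest_sub _ _ (@cylinders n) [set S | measurable (pre S)]); last first.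
    move=> _ [m [f ->]]; rewrite /= cylinderE pre_prefix; exact: measurable_itv.
  split => [|Y mY|F mF] /=.
  - by rewrite /pre preimage_set0 setI0.
  - rewrite /= in mY; rewrite (_ : pre _ = I `\` pre Y); first exact: measurableD.
    apply/seteqP; split=> x [Ix h]; split => //.
      by case: h => _ nY [_].
    by split => // Yx; apply: h.
  - rewrite (_ : pre _ = \bigcup_i pre (F i)); first by apply: bigcup_measurable => i _; exact: mF.
    by rewrite /pre preimage_bigcup setI_bigcupr.
exists (fun S => lebesgue_measure (pre S)); split => [|S|F mF tF||m r].
- by rewrite /pre preimage_set0 setI0 measure0.
- exact: measure_ge0.
- rewrite (_ : pre _ = \bigcup_i pre (F i)).
    rewrite measure_bigcup //; first by apply: eq_eseriesl => i; rewrite in_setT.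
      by move=> i _; exact: mpre.
    move=> i j _ _ [x [[_ xi] [_ xj]]]; apply: tF => //; by exists (X x).
  by rewrite /pre preimage_bigcup setI_bigcupr.
- rewrite /pre preimage_setT setIT /I lebesgue_measure_itv /= lte_fin ltr01.
  by rewrite oppr0 adde0.
- rewrite pre_prefix lebesgue_measure_itv /= lte_fin ltrDl.
  (* An empty interval occurs when the prefix has probability zero. *)
  case: ltP => h; first by rewrite -EFinB addrAC subrr add0r.
  by congr _%:E; apply/eqP; rewrite eq_le h run_prob_ge0.
Qed.

End RunMeasureExistence.

(** * Value functions and decidability *)

Section LimitValues.
Context (R : realType).
Implicit Types (v : nat -> \bar R) (x y : \bar R).

Lemma limn_einfE v : limn_einf v = ereal_sup (range (einfs v)).
Proof. by rewrite limn_einf_lim; apply: cvg_lim => //; exact: cvg_einfs_sup. Qed.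

Lemma limn_esupE v : limn_esup v = ereal_inf (range (esups v)).
Proof. by rewrite limn_esup_lim; apply: cvg_lim => //; exact: cvg_esups_inf. Qed.

Lemma limn_einf_ge v x N : (forall i, (N <= i)%N -> (x <= v i)%E) -> (x <= limn_einf v)%E.
Proof.
move=> h; rewrite limn_einfE; apply: (@le_trans _ _ (einfs v N)).
  by apply: le_ereal_inf_tmp => _ [i /= Ni <-]; exact: h.
by apply: ereal_sup_ubound; exists N.
Qed.

Lemma limn_einf_gt v x : (x < limn_einf v)%E ->
  exists N, forall i, (N <= i)%N -> (x < v i)%E.
Proof.
rewrite limn_einfE => /ereal_sup_gt[_ [N _ <-] h]; exists N => i Ni.
by apply: lt_le_trans h _; apply: ereal_inf_lbound; exists i.
Qed.

Lemma limn_esup_ge v x : (forall N, exists2 i, (N <= i)%N & (x <= v i)%E) ->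
  (x <= limn_esup v)%E.
Proof.
move=> h; rewrite limn_esupE; apply: le_ereal_inf_tmp => _ [N _ <-].
have [i Ni xi] := h N; apply: (le_trans xi).
by apply: ereal_sup_ubound; exists i.
Qed.

Lemma limn_esup_gt v x N : (x < limn_esup v)%E -> exists2 i, (N <= i)%N & (x < v i)%E.
Proof.
rewrite limn_esupE => h; have : (x < esups v N)%E.
  by apply: lt_le_trans h _; apply: ereal_inf_lbound; exists N.
by move/ereal_sup_gt => [_ [i /= Ni <-] xi]; exists i.
Qed.

End LimitValues.

(** * Limit values of an automaton as eventual safety of its runs *)

Section Automaton.
Context (R : realType) (n0 k : nat) (A : pwa n0.+1 k) (vA : pwa_valid A).
Local Notation n := n0.+1.
Local Notation T := (g_sigma_algebraType (@cylinders n)).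

Let ini p : R := ratr (rhoI A p).
Let D p a p' : R := ratr (delta A p a p').
Let weight p a p' : R := ratr (gamma A p a p').

Let ini_ge0 p : 0 <= ini p.
Proof. by case: vA => h _ _ _; rewrite /ini ler0q. Qed.

Let ini_sum1 : \sum_p ini p = 1.
Proof. by case: vA => _ h _ _; rewrite /ini -rmorph_sum h rmorph1. Qed.

Let D_ge0 p a p' : 0 <= D p a p'.
Proof. by case: vA => _ _ h _; rewrite /D ler0q. Qed.

Let D_sum1 p a : \sum_p' D p a p' = 1.
Proof. by case: vA => _ _ _ h; rewrite /D -rmorph_sum h rmorph1. Qed.

Lemma prefix_probE w m (r : nat -> 'I_n) :
  prefix_prob R A w (fun i : 'I_m.+1 => r i) = run_prob ini D w m r.
Proof.
by rewrite /prefix_prob /run_prob; congr (_ * _); apply: eq_bigr => i _; rewrite lift0.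
Qed.

Lemma run_measure_measure w mu : run_measure A w mu ->
  exists P : {measure set T -> \bar R},
    (forall X : set T, measurable X -> P X = mu X) /\
    (forall m r, P (prefix_set m r) = (run_prob ini D w m r)%:E).
Proof.
case=> mu0 mu_ge0 mu_sigma _ mu_cyl.
(* Outside the sigma-algebra [mu] is unconstrained, whereas [P] must be non-negative on every
   set. *)
pose P (X : set T) := if `[< measurable X >] then mu X else 0%E.
have PE X : measurable X -> P X = mu X by move=> mX; rewrite /P asboolT.
have P0 : P set0 = 0%E by rewrite PE // mu0.
have P_ge0 X : (0 <= P X)%E by rewrite /P; case: asboolP => // mX; exact: mu_ge0.
have P_sigma : semi_sigma_additive P.
  move=> F mF tF mcF; rewrite PE // mu_sigma //.
  rewrite (_ : (fun m => _) = (fun m => (\sum_(0 <= i < m) mu (F i))%E)).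
    by apply: is_cvg_nneseries => i _ _; apply: mu_ge0; exact: mF.
  by apply/funext => m; apply: eq_bigr => i _; rewrite PE.
pose M := isMeasure.Build _ T R P P0 P_ge0 P_sigma.
pose Q : {measure set T -> \bar R} := HB.pack P M.
exists Q; split=> [|m r]; first exact: PE.
rewrite [LHS]PE; last exact: measurable_prefix.
by rewrite prefix_setE mu_cyl prefix_probE.
Qed.

(** Both problems quantify over all run measures of a word, so refuting either needs at least
    one. *)
Lemma exists_run_measure w : exists mu, run_measure (R := R) A w mu.
Proof.
have [mu [h0 hge hs h1 hp]] := run_measure_exists ini_ge0 ini_sum1 D_ge0 D_sum1 w.
exists mu; split => // m f.
rewrite cylinderE hp -prefix_probE; congr (prefix_prob _ _ _ _)%:E.
by apply/funext => i; rewrite inord_val.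
Qed.

Definition at_least (eta : R) p a p' := eta <= weight p a p'.
Definition below (eta : R) p a p' := ~~ at_least eta p a p'.

(** Finitely many weights occur, so those below [eta] have a maximum ([eta - 1] is the default). The
    gap turns strict bounds obtained from limits and suprema into weights at least [eta]. *)
Lemma weight_gap (eta : R) :
  exists2 e, e < eta & forall p a p', e < weight p a p' -> at_least eta p a p'.
Proof.
pose X := ('I_n * 'I_k * 'I_n)%type.
pose e := \big[Num.max/eta - 1]_(x : X | weight x.1.1 x.1.2 x.2 < eta) weight x.1.1 x.1.2 x.2.
exists e; first by apply: bigmax_lt => //; rewrite ltrBlDr ltrDl ltr01.
move=> p a p'; rewrite /at_least !leNgt; apply: contraL => h.
rewrite ltNge negbK.
exact: (@le_bigmax_cond _ _ X (eta - 1) (p, a, p') (fun x => weight x.1.1 x.1.2 x.2 < eta)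
  (fun x => weight x.1.1 x.1.2 x.2)).
Qed.

Lemma LimInf_coBuchi w (eta : R) :
  [set r | (eta%:E <= LimInfVal (weight_seq R A w r))%E] = coBuchi (at_least eta) w.
Proof.
apply/seteqP; split => r /=.
  have [e e_eta gap] := weight_gap eta => h.
  have [|N hN] := @limn_einf_gt _ (weight_seq R A w r) e%:E.
    by apply: lt_le_trans h; rewrite lte_fin.
  by exists N => // i Ni; apply: gap; rewrite -lte_fin; exact: hN.
move=> [N _ h]; apply: (@limn_einf_ge _ _ _ N) => i Ni.
by rewrite lee_fin; exact: h.
Qed.

Lemma LimSup_coBuchi w (eta : R) :
  [set r | (eta%:E <= LimSupVal (weight_seq R A w r))%E] = ~` coBuchi (below eta) w.
Proof.
apply/seteqP; split => r /=.
  have [e e_eta gap] := weight_gap eta => h [N _ hN].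
  have [|i Ni hi] := @limn_esup_gt _ (weight_seq R A w r) e%:E N.
    by apply: lt_le_trans h; rewrite lte_fin.
  by have /negP := hN i Ni; apply; apply: gap; rewrite -lte_fin.
move=> h; apply: limn_esup_ge => N; apply: contrapT => hN; apply: h.
exists N => // i Ni; apply/negP => hi; apply: hN; exists i => //.
Qed.

Lemma le_coBuchi (s s' : 'I_n -> 'I_k -> 'I_n -> bool) w :
  (forall p a p', s p a p' -> s' p a p') -> coBuchi s w `<=` coBuchi s' w.
Proof. by move=> h r [N _ hN]; exists N => // i Ni; apply: h; exact: hN. Qed.

Definition coBuchi_feasible (s : 'I_n -> 'I_k -> 'I_n -> bool) :=
  exists2 q, reachable (fun p => 0 < ini p) (fun p a p' => 0 < D p a p') q &
    exists v : nat -> 'I_k,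
      forall l, surely_safe (fun p a p' => 0 < D p a p') s (mkseq v l) q.

Definition coBuchi_infeasible (s : 'I_n -> 'I_k -> 'I_n -> bool) :=
  exists m, forall q u, reachable (fun p => 0 < ini p) (fun p a p' => 0 < D p a p') q ->
     size u = m -> ~~ surely_safe (fun p a p' => 0 < D p a p') s u q.

Lemma feasible_word s : coBuchi_feasible s ->
  exists w, forall P : {measure set T -> \bar R},
    (forall m r, P (prefix_set m r) = (run_prob ini D w m r)%:E) ->
    (0 < P (coBuchi s w))%E.
Proof.
case=> q rq [v hv]; have [w [t [r [wt rt pr]]]] := reach_run v rq.
exists w => P hP; apply: (coBuchi_pos D_ge0 D_sum1 hP pr) => l.
have := hv l; rewrite rt /mkseq; congr surely_safe.
by rewrite -[t in RHS]addn0 iotaDl -map_comp; apply: eq_map => i /=; rewrite wt.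
Qed.

Lemma PosLimInf_feasible (nu : rat) :
  coBuchi_feasible (at_least (ratr nu)) -> PosLimInf_nonempty R A nu.
Proof.
move=> /feasible_word[w hw]; exists w => mu /run_measure_measure[P [PE /hw h]].
apply: ereal_sup_ubound; exists (ratr nu) => //=.
by rewrite LimInf_coBuchi -PE //; exact: measurable_coBuchi.
Qed.

(** The supremum yields only some [eta] above [e], possibly below [ratr nu]. By the gap, weights at
    least [eta] are at least [ratr nu], so the event for [eta] lies in a null set. *)
Lemma PosLimInf_infeasible (nu : rat) :
  coBuchi_infeasible (at_least (ratr nu)) -> ~ PosLimInf_nonempty R A nu.
Proof.
case=> m hm [w hw]; have [mu hmu] := exists_run_measure w.
have [P [PE hP]] := run_measure_measure hmu.
have [e e_nu gap] := weight_gap (ratr nu).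
have : (e%:E < L_pos A (@LimInfVal R) w mu)%E.
  by apply: lt_le_trans (hw _ hmu); rewrite lte_fin.
move=> /ereal_sup_gt[_ [eta /= + <-]]; rewrite LimInf_coBuchi lte_fin => + e_eta.
rewrite -PE; last exact: measurable_coBuchi.
apply/negP; rewrite -leNgt -(coBuchi_null ini_ge0 D_ge0 D_sum1 hP hm).
rewrite le_measure ?inE; [|exact: measurable_coBuchi|exact: measurable_coBuchi|].
  by [].
by apply: le_coBuchi => p a p' h; apply: gap; exact: lt_le_trans e_eta h.
Qed.

Lemma AsLimSup_infeasible (nu : rat) :
  coBuchi_infeasible (below (ratr nu)) -> AsLimSup_universal R A nu.
Proof.
case=> m hm w mu hmu; have [P [PE hP]] := run_measure_measure hmu.
have P1 : P setT = 1%E by rewrite PE //; case: hmu.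
apply: ereal_sup_ubound; exists (ratr nu) => //=.
have mC : measurable (coBuchi (below (ratr nu)) w : set T) by exact: measurable_coBuchi.
rewrite LimSup_coBuchi -PE; last exact: measurableC.
rewrite -[RHS]P1 -[in RHS](setvU (coBuchi (below (ratr nu)) w)) measureU //.
- by rewrite [X in (_ + X)%E](coBuchi_null ini_ge0 D_ge0 D_sum1 hP hm) adde0.
- exact: measurableC.
- by rewrite setICl.
Qed.

(** Again only some [eta] above [e] is available. Transitions below [ratr nu] are below [eta] by the
    gap, so an event of positive mass would lie in the complement of an almost sure one. *)
Lemma AsLimSup_feasible (nu : rat) :
  coBuchi_feasible (below (ratr nu)) -> ~ AsLimSup_universal R A nu.
Proof.
move=> /feasible_word[w hw] hu; have [mu hmu] := exists_run_measure w.
have [P [PE /hw hP]] := run_measure_measure hmu.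
have P1 : P setT = 1%E by rewrite PE //; case: hmu.
have [e e_nu gap] := weight_gap (ratr nu).
have : (e%:E < L_as A (@LimSupVal R) w mu)%E.
  by apply: lt_le_trans (hu _ _ hmu); rewrite lte_fin.
move=> /ereal_sup_gt[_ [eta /= + <-]]; rewrite LimSup_coBuchi lte_fin => + e_eta.
have mC : measurable (coBuchi (below eta) w : set T) by exact: measurable_coBuchi.
rewrite -PE; last exact: measurableC.
move=> Peta.
have : (P (coBuchi (below eta) w) <= 0)%E.
  have : P setT = (P (~` coBuchi (below eta) w) + P (coBuchi (below eta) w))%E.
    by rewrite -measureU ?setvU ?setICl //; exact: measurableC.
  rewrite P1 [X in (X + _)%E]Peta.
  by case: (P (coBuchi _ _)) => // x [] /eqP; rewrite addrC -subr_eq subrr lee_fin => /eqP<-.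
apply/negP; rewrite -ltNge; apply: lt_le_trans hP _.
rewrite le_measure ?inE //; first exact: measurable_coBuchi.
apply: le_coBuchi => p a p'; apply: contra => h; apply: gap.
exact: lt_le_trans e_eta h.
Qed.

(** A negative answer is recorded as a uniform length bound, the form that [coBuchi_null]
    consumes. *)
Lemma code_decisionE above (nu : rat) :
  let s := if above then at_least (ratr nu) else below (ratr nu) in
  if code_decision above (enc_input A nu) then coBuchi_feasible s else coBuchi_infeasible s.
Proof.
move=> s; case: vA => rho0 _ delta0 _.
rewrite /code_decision /enc_input /enc_pwa !(unpair1K, unpair2K) /=.
set ini' := (fun p => _); set step' := (fun p a p' => _ != 0%N); set safe' := (fun p a p' => _).
have iniE (p : 'I_n) : ini' p = (0 < ini p).
  rewrite /ini' code_nthE; last by rewrite size_map size_enum_ord.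
  by rewrite (nth_map p) ?size_enum_ord // nth_ord_enum code_rat_pos // /ini ltr0q.
have stepE (p : 'I_n) (a : 'I_k) (p' : 'I_n) : step' p a p' = (0 < D p a p').
  by rewrite /step' (@code_nth_table n k (fun p a p' => enc_rat (delta A p a p')))
    code_rat_pos // /D ltr0q.
have safeE (p : 'I_n) (a : 'I_k) (p' : 'I_n) : safe' p a p' = s p a p'.
  rewrite /safe' (@code_nth_table n k (fun p a p' => enc_rat (gamma A p a p'))).
  by rewrite code_rat_leE /s; case: (above); rewrite /below /at_least /weight ler_rat.
case: ifP => [|/negbT] h; first exact: decision_sound h.
exact: decision_complete h.
Qed.

End Automaton.

Theorem theorem9 :
  decidable_problem PosLimInf_nonempty /\ decidable_problem AsLimSup_universal.
Proof.
split.
- have [p hp] := dec_code_decision true.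
  exists p => R [|n] k A nu vA.
    (* Without states the initial probabilities would sum to 0. *)
    by case: vA => _ /esym/eqP h _ _; rewrite big_ord0 oner_eq0 in h.
  exists (code_decision true (enc_input A nu)); split; first exact: (hp [:: _]).
  have := code_decisionE R vA true nu; case: (code_decision true _) => /= h; split => //.
    by move=> _; exact: PosLimInf_feasible.
  by move/(PosLimInf_infeasible vA h).
(* The test detects a counterexample word to universality, hence the negation. *)
- have [p hp] := dec_not (dec_code_decision false).
  exists p => R [|n] k A nu vA.
    by case: vA => _ /esym/eqP h _ _; rewrite big_ord0 oner_eq0 in h.
  exists (~~ code_decision false (enc_input A nu)); split; first exact: (hp [:: _]).
  have := code_decisionE R vA false nu; case: (code_decision false _) => /= h; split => //.
    by move/(AsLimSup_feasible vA h).
  by move=> _; exact: AsLimSup_infeasible.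
Qed.
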